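(* Let $\{G_n\}_{n\ge 0}$ be a Gibonacci sequence and let $\{G'_n\}_{n\ge 0}$ be the associated modified Gibonacci sequence. For all integers $n\geq 1$, $$G_0(G_n-G'_{n-1})=G_1(G'_n-G_{n-1}).$$
   Context: A Gibonacci sequence is a sequence satisfying $G_n=G_{n-1}+G_{n-2}$ for $n\ge2$, with initial values $G_0,G_1$ chosen freely (here arbitrary integers). The associated modified Gibonacci sequence is defined by $G'_0=G_1$, $G'_1=G_0$ and $G'_n=G'_{n-1}+G'_{n-2}$ for $n\ge 2$. *)

(* Defs.v *)
From mathcomp Require Import all_boot all_order all_algebra.
Set Implicit Arguments.
Unset Strict Implicit.
Unset Printing Implicit Defensive.
Import GRing.Theory.
Local Open Scope ring_scope.

Definition gibonacci (G : nat -> int) : Prop :=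
  forall n : nat, (2 <= n)%N -> G n = G (n - 1)%N + G (n - 2)%N.

Definition modified_gibonacci (G G' : nat -> int) : Prop :=
  [/\ G' 0%N = G 1%N, G' 1%N = G 0%N & gibonacci G'].

(* Main.v *)
Require Import Defs.
From mathcomp Require Import all_boot all_order all_algebra.
From mathcomp Require Import ring.
Import GRing.Theory.
Local Open Scope ring_scope.

(** Put [n = m + 1]. As functions of [m], the differences [G (m + 1) - G' m]
    and [G' (m + 1) - G m] satisfy the Fibonacci recurrence. They start with
    [0, G 1] and [0, G 0] respectively, since [G'] swaps the initial values of
    [G]; so they are [G 1] and [G 0] times the Fibonacci sequence. Multiplying
    the first by [G 0] and the second by [G 1] gives two Gibonacci sequences
    that both start with [0, G 0 * G 1], hence coincide ([gibonacci_unique]). *)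

Lemma gibonacciE (u : nat -> int) :
  gibonacci u <-> forall n, u n.+2 = u n.+1 + u n.
Proof.
split=> [hu n | hu [|[|n]] // _]; last by rewrite subn1 subn2 /= hu.
by rewrite hu // subn1 subn2.
Qed.

Lemma gibonacci_unique (u v : nat -> int) :
  gibonacci u -> gibonacci v -> u 0%N = v 0%N -> u 1%N = v 1%N -> u =1 v.
Proof.
move=> /gibonacciE hu /gibonacciE hv uv0 uv1 n.
(* The recurrence has order two, so the induction carries consecutive pairs. *)
suff [] : u n = v n /\ u n.+1 = v n.+1 by [].
by elim: n => [|n [IHn IHn1]]; split=> //; rewrite hu hv IHn IHn1.
Qed.

Lemma gibonacci_shift_diff (c : int) (u v : nat -> int) :
  gibonacci u -> gibonacci v -> gibonacci (fun m => c * (u m.+1 - v m)).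
Proof.
move=> /gibonacciE hu /gibonacciE hv; apply/gibonacciE=> m.
by rewrite (hu m.+1) (hv m); ring.
Qed.

Theorem mainTheorem5 (G G' : nat -> int) (hG : gibonacci G)
    (hG' : modified_gibonacci G G') (n : nat) (hn : (1 <= n)%N) :
  G 0%N * (G n - G' (n - 1)%N) = G 1%N * (G' n - G (n - 1)%N).
Proof.
case: hG' => G'0 G'1 gibG'.
case: n hn => // m _; rewrite subn1 /=.
apply: (gibonacci_unique _ _ (gibonacci_shift_diff _ _ _ hG gibG')
                             (gibonacci_shift_diff _ _ _ gibG' hG)).
  by rewrite G'0 G'1 !subrr !mulr0.
move/gibonacciE: hG => /(_ 0%N) ->; move/gibonacciE: gibG' => /(_ 0%N) ->.
by rewrite G'0 G'1; ring.
Qed.
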